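(* Let $k\ge 2$ be an integer, and define $r:=\left\lfloor\frac{k-1}{\varphi}\right\rfloor$. Then $k$ is admissible if and only if at least one of the following scenarios occurs. 1. There exists $n\ge 1$ such that $k=(F_n-1)(F_{n+1}-1)$. In this case (for such an $n$), the unique nonnegative integral solution of $$1+F_nx+F_{n+1}y=\frac{(F_n-1)(F_{n+1}-1)}{k}\qquad ( * )$$ is $(x,y)=(0,0)$. 2. There exists an even integer $n\ge 2$ such that $k<F_{n+1}$, $$F_n+rF_{n+1}\equiv -1 \pmod k\quad\text{and}\quad rF_n+F_{n+1}\equiv 1\pmod k.$$ In this case (for such an $n$), the unique nonnegative integral solution of $( * )$ is $$(x,y)=\left(F_n-\frac{F_n+rF_{n+1}+1}{k},\ \frac{rF_n+F_{n+1}-1}{k}-F_{n-1}\right).$$ 3. There exists an odd integer $n\ge 1$ such that $k<F_{n+1}$, $$F_n+(r+1)F_{n+1}\equiv 1\pmod k\quad\text{and}\quad (r-1)F_n+F_{n+1}\equiv -1\pmod k.$$ In this case (for such an $n$), the unique nonnegative integral solution of $( * )$ is $$(x,y)=\left(\frac{(r+1)F_{n+1}+F_n-1}{k}-F_n,\ F_{n-1}-\frac{F_{n+1}+(r-1)F_n+1}{k}\right).$$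
   Context: $(F_n)$ is the Fibonacci sequence with $F_1=F_2=1$ and $F_n=F_{n-1}+F_{n-2}$ for all $n\in\mathbb{Z}$ (so $F_0=0$). $\varphi=(1+\sqrt5)/2$. A positive integer $k$ is called admissible if there exist an integer $n\ge1$ and nonnegative integers $x,y$ satisfying $1+F_nx+F_{n+1}y=\frac{(F_n-1)(F_{n+1}-1)}{k}$. *)

(* Defs.v *)
From Stdlib Require Export Reals ZArith.

Open Scope Z_scope.

(* Only nonnegative indices occur in the statement, so the index is a [nat]. *)
Fixpoint fib (n : nat) : Z :=
  match n with
  | O => 0
  | S m => match m with
           | O => 1
           | S p => fib m + fib p
           end
  end.

Definition phi : R := ((1 + sqrt 5) / 2)%R.

(* The right-hand side is the exact quotient, which need not be an integer;
   hence the equation is read in [R]. *)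
Definition solution (k : Z) (n : nat) (p : Z * Z) : Prop :=
  let (x, y) := p in
  0 <= x /\ 0 <= y /\
  IZR (1 + fib n * x + fib (n + 1) * y)
  = (IZR ((fib n - 1) * (fib (n + 1) - 1)) / IZR k)%R.

Definition admissible (k : Z) : Prop :=
  0 < k /\ exists (n : nat) (x y : Z), (1 <= n)%nat /\ solution k n (x, y).

Definition scenario1 (k : Z) (n : nat) : Prop :=
  (1 <= n)%nat /\ k = (fib n - 1) * (fib (n + 1) - 1).

Definition scenario2 (k r : Z) (n : nat) : Prop :=
  Nat.Even n /\ (2 <= n)%nat /\ k < fib (n + 1) /\
  (fib n + r * fib (n + 1)) mod k = (-1) mod k /\
  (r * fib n + fib (n + 1)) mod k = 1 mod k.

Definition scenario3 (k r : Z) (n : nat) : Prop :=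
  Nat.Odd n /\ (1 <= n)%nat /\ k < fib (n + 1) /\
  (fib n + (r + 1) * fib (n + 1)) mod k = 1 mod k /\
  ((r - 1) * fib n + fib (n + 1)) mod k = (-1) mod k.

(* In the two formulas below, the congruences of the corresponding scenario
   say exactly that [k] divides the numerators, so [Z.div] is exact there. *)
Definition sol2 (k r : Z) (n : nat) : Z * Z :=
  (fib n - (fib n + r * fib (n + 1) + 1) / k,
   (r * fib n + fib (n + 1) - 1) / k - fib (n - 1)).

Definition sol3 (k r : Z) (n : nat) : Z * Z :=
  (((r + 1) * fib (n + 1) + fib n - 1) / k - fib n,
   fib (n - 1) - (fib (n + 1) + (r - 1) * fib n + 1) / k).

(* Main.v *)
Require Import Defs.
From Stdlib Require Import Reals ZArith Lia Lra.
Open Scope Z_scope.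

(** Write [a = F_n], [b = F_{n+1}], [e = (-1)^n], so that Cassini's identity
    reads [b^2 - a b - a^2 = e].  The equation is [k (1 + a x + b y) =
    (a - 1) (b - 1)], and it has at most one nonnegative solution, because
    [a] and [b] are coprime and any such solution has [x < b].

    Modulo [b], Cassini's identity says that [-e a] is the inverse of [a].
    Hence the integer solutions [(x, y)] are exactly those for which some
    integer [s] satisfies ([solution_param])
<<
      k x + 1 = e ((k - 1) a - s b),
      k y + 1 = e (s a - (k - 1) (b - a)) + a.
>>
    Put [w = 1 / phi = phi - 1].  The quotients [a / b] and [(b - a) / a] are
    consecutive convergents of [w], on the sides of it prescribed by [e].
    If [x] and [y] are nonnegative, the two equations therefore force
    [0 < e ((k - 1) w - s) < 1], which means [s = r] for even [n] and
    [s = r + 1] for odd [n] ([parameter_near]); the equations then become the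
    congruences and the formulas of scenarios 2 and 3.  The bound
    [k < F_{n+1}] holds as soon as [(x, y) <> (0, 0)], and [(0, 0)] is a
    solution precisely in scenario 1.

    Conversely, for this [s] the congruences give integers [x] and [y]
    satisfying the two equations.  No fraction with denominator
    [k - 1 < a + b] lies strictly between [a / b] and [(b - a) / a]
    ([no_fraction_between]); since [s / (k - 1)] and [(s + e) / (k - 1)]
    enclose [w], they also enclose both convergents, so that [k x + 1] and
    [k y + 1] are nonnegative ([parameter_nonneg]).  As [k >= 2], so are [x]
    and [y]. *)

(** * Fibonacci numbers *)

Lemma fib_succ_succ n : fib (S n + 1) = fib (n + 1) + fib n.
Proof. rewrite !Nat.add_1_r. reflexivity. Qed.

Lemma fib_pred n : (1 <= n)%nat -> fib (n - 1) = fib (n + 1) - fib n.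
Proof.
  destruct n as [|n]; [lia|intros _].
  rewrite fib_succ_succ. replace (S n - 1)%nat with n by lia.
  rewrite Nat.add_1_r. lia.
Qed.

Lemma fib_bounds n : 0 <= fib n <= fib (n + 1) /\ 1 <= fib (n + 1).
Proof.
  induction n as [|n IH]; [simpl; lia|].
  rewrite fib_succ_succ, <- Nat.add_1_r. lia.
Qed.

Lemma fib_pos n : (1 <= n)%nat -> 1 <= fib n <= fib (n + 1).
Proof.
  intros hn. pose proof (fib_bounds (n - 1)) as H. pose proof (fib_bounds n).
  replace (n - 1 + 1)%nat with n in H by lia. lia.
Qed.

Lemma cassini n :
  fib (n + 1) * fib (n + 1) - fib n * fib (n + 1) - fib n * fib n
  = if Nat.even n then 1 else -1.
Proof.
  induction n as [|n IH]; [reflexivity|].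
  rewrite fib_succ_succ, Nat.even_succ, <- Nat.negb_even.
  rewrite <- (Nat.add_1_r n).
  destruct (Nat.even n); cbn [negb]; lia.
Qed.

Lemma cassini_even n : Nat.Even n ->
  fib (n + 1) * fib (n + 1) - fib n * fib (n + 1) - fib n * fib n = 1.
Proof. intros h%Nat.even_spec. now rewrite cassini, h. Qed.

Lemma cassini_odd n : Nat.Odd n ->
  fib (n + 1) * fib (n + 1) - fib n * fib (n + 1) - fib n * fib n = -1.
Proof.
  intros h%Nat.odd_spec. rewrite <- Nat.negb_even in h.
  rewrite cassini. now destruct (Nat.even n).
Qed.

(** * The equation over the integers *)

Lemma solution_iff k n x y : 0 < k ->
  solution k n (x, y) <->
  0 <= x /\ 0 <= y /\
  k * (1 + fib n * x + fib (n + 1) * y) = (fib n - 1) * (fib (n + 1) - 1).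
Proof.
  intros hk. unfold solution.
  assert (hk' : IZR k <> 0%R) by (apply not_0_IZR; lia).
  split; intros (hx & hy & h); (split; [|split]); trivial.
  - apply eq_IZR. rewrite mult_IZR, h. field. exact hk'.
  - rewrite <- h, mult_IZR. field. exact hk'.
Qed.

(** The identity [b (b - a) - a a = e] is a Bezout relation, which shows that
    two solutions differ by a multiple of [(b, -a)]. *)
Lemma solution_unique k n x y x' y' : 0 < k -> (1 <= n)%nat ->
  solution k n (x, y) -> solution k n (x', y') -> (x, y) = (x', y').
Proof.
  intros hk hn (hx & hy & h)%solution_iff (hx' & hy' & h')%solution_iff;
    trivial.
  pose proof (fib_pos n hn) as hp. pose proof (cassini n) as hc.
  set (a := fib n) in *. set (b := fib (n + 1)) in *.
  assert (E : a * (x - x') = b * (y' - y)).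
  { assert (1 + a * x + b * y = 1 + a * x' + b * y')
      by (apply Z.mul_reg_l with k; lia). lia. }
  assert (ht : exists t, x - x' = b * t).
  { exists ((if Nat.even n then 1 else -1)
            * ((b - a) * (x - x') - a * (y' - y))).
    transitivity ((if Nat.even n then 1 else -1)
                  * ((b * (b - a)) * (x - x') - a * (b * (y' - y)))); [|ring].
    rewrite <- E.
    transitivity ((if Nat.even n then 1 else -1)
                  * (b * b - a * b - a * a) * (x - x')); [|ring].
    rewrite hc. destruct (Nat.even n); ring. }
  destruct ht as [t ht].
  assert (hxb : forall u v, 0 <= u -> 0 <= v ->
                k * (1 + a * u + b * v) = (a - 1) * (b - 1) -> u < b).
  { intros u v hu hv huv.
    assert (0 <= a * u) by (apply Z.mul_nonneg_nonneg; lia).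
    assert (0 <= b * v) by (apply Z.mul_nonneg_nonneg; lia).
    assert (1 + a * u + b * v <= (a - 1) * (b - 1)) by nia.
    apply Z.mul_lt_mono_pos_l with a; lia. }
  pose proof (hxb x y hx hy h). pose proof (hxb x' y' hx' hy' h').
  assert (t = 0) by nia. subst t.
  assert (x = x') by lia. subst x'. f_equal. nia.
Qed.

Lemma solution_param_exists e k a b x y : e * e = 1 ->
  b * b - a * b - a * a = e ->
  k * (1 + a * x + b * y) = (a - 1) * (b - 1) ->
  exists s, k * x + 1 = e * ((k - 1) * a - s * b) /\
            k * y + 1 = e * (s * a - (k - 1) * (b - a)) + a.
Proof.
  intros he hc h.
  (* Cramer's rule in the unknowns [s] and [k - 1], with determinant [e]. *)
  exists (a * (a - 1 - k * y) - (b - a) * (k * x + 1)).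
  assert (h0 : k * (1 + a * x + b * y) - (a - 1) * (b - 1) = 0) by lia.
  assert (hc0 : b * b - a * b - a * a - e = 0) by lia.
  assert (he0 : e * e - 1 = 0) by lia.
  split; apply Z.sub_move_0_r.
  - transitivity (- e * a * (k * (1 + a * x + b * y) - (a - 1) * (b - 1))
      - e * (k * x + 1) * (b * b - a * b - a * a - e)
      - (k * x + 1) * (e * e - 1)); [ring|].
    rewrite h0, hc0, he0. ring.
  - transitivity (e * (b - a) * (k * (1 + a * x + b * y) - (a - 1) * (b - 1))
      - e * (k * y + 1 - a) * (b * b - a * b - a * a - e)
      - (k * y + 1 - a) * (e * e - 1)); [ring|].
    rewrite h0, hc0, he0. ring.
Qed.

Lemma solution_param e k a b x y : e * e = 1 ->
  b * b - a * b - a * a = e ->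
  k * (1 + a * x + b * y) = (a - 1) * (b - 1) <->
  exists s, k * x + 1 = e * ((k - 1) * a - s * b) /\
            k * y + 1 = e * (s * a - (k - 1) * (b - a)) + a.
Proof.
  intros he hc. split; [now apply solution_param_exists|].
  intros (s & hx & hy).
  transitivity (a * (k * x + 1) + b * (k * y + 1) + k - a - b); [ring|].
  rewrite hx, hy.
  transitivity (k - (k - 1) * (e * (b * b - a * b - a * a)) + a * b - a - b);
    [ring|].
  rewrite hc, he. ring.
Qed.

(** * Rational approximations of the inverse golden ratio *)

Lemma phi_square : (phi * phi = phi + 1)%R.
Proof.
  unfold phi. pose proof (sqrt_sqrt 5 ltac:(lra)). nra.
Qed.

Lemma phi_gt_1 : (1 < phi)%R.
Proof.
  unfold phi. pose proof (sqrt_lt_1 1 5 ltac:(lra) ltac:(lra) ltac:(lra)) as h.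
  rewrite sqrt_1 in h. lra.
Qed.

Lemma floor_div_phi k r : r = Zfloor ((IZR k - 1) / phi)%R ->
  (IZR r <= IZR (k - 1) * (phi - 1) < IZR r + 1)%R.
Proof.
  intros ->. pose proof phi_gt_1. pose proof phi_square.
  replace (IZR (k - 1) * (phi - 1))%R with ((IZR k - 1) / phi)%R.
  - apply Zfloor_bound.
  - rewrite minus_IZR. apply Rmult_eq_reg_r with phi; [|lra].
    replace ((IZR k - 1) * (phi - 1) * phi)%R
      with ((IZR k - 1) * (phi * phi - phi))%R by ring.
    rewrite phi_square. field. lra.
Qed.

(** Both [a / b] and [(b - a) / a] are convergents of [phi - 1]; the sign [e]
    tells on which side of it each of them lies. *)
Lemma convergent_sides e a b : e * e = 1 -> 1 <= a <= b ->
  b * b - a * b - a * a = e ->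
  (0 < IZR e * ((phi - 1) * IZR b - IZR a))%R /\
  (0 < IZR e * (IZR b - IZR a - (phi - 1) * IZR a))%R.
Proof.
  intros he [ha hb] hc. pose proof phi_gt_1 as h1. pose proof phi_square as h2.
  apply IZR_le in ha, hb. apply (f_equal IZR) in he, hc.
  rewrite ?minus_IZR, ?mult_IZR in *.
  set (A := IZR a) in *. set (B := IZR b) in *. set (E := IZR e) in *.
  assert (hD : (0 < E * (B - A - (phi - 1) * A))%R).
  { apply Rmult_lt_reg_r with (B + (phi - 1) * A)%R; [nra|].
    replace (E * (B - A - (phi - 1) * A) * (B + (phi - 1) * A))%R
      with (E * (B * B - A * B - (phi * phi - phi) * (A * A)))%R by ring.
    replace (phi * phi - phi)%R with 1%R by lra. rewrite Rmult_1_l, hc. lra. }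
  split; [|exact hD].
  replace (E * ((phi - 1) * B - A))%R
    with ((phi - 1) * (E * (B - A - (phi - 1) * A)))%R.
  - apply Rmult_lt_0_compat; lra.
  - replace ((phi - 1) * (E * (B - A - (phi - 1) * A)))%R
      with (E * ((phi - 1) * B - (phi * phi - phi) * A))%R by ring.
    replace (phi * phi - phi)%R with 1%R by lra. ring.
Qed.

(** A fraction [p / q] strictly between [a / b] and [(b - a) / a] is a positive
    integral combination of the two, so that [q >= a + b]. *)
Lemma no_fraction_between e a b p q : e * e = 1 -> 1 <= a <= b ->
  b * b - a * b - a * a = e -> q < a + b ->
  0 < e * (q * (b - a) - p * a) -> e * (p * b - q * a) <= 0.
Proof.
  intros he hab hc hq hu.
  set (u := e * (q * (b - a) - p * a)) in *.
  set (v := e * (p * b - q * a)).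
  assert (hE : q = u * b + v * a).
  { transitivity (q * (e * (b * b - a * b - a * a))); [|unfold u, v; ring].
    rewrite hc, he. ring. }
  nia.
Qed.

Lemma parameter_near e a b q s : e * e = 1 -> 1 <= a <= b ->
  b * b - a * b - a * a = e -> 0 <= q ->
  0 < e * (q * a - s * b) -> 0 < e * (s * a - q * (b - a)) + a ->
  (0 < IZR e * (IZR q * (phi - 1) - IZR s) < 1)%R.
Proof.
  intros he hab hc hq h1 h2.
  destruct (convergent_sides e a b he hab hc) as [c1 c2].
  destruct hab as [ha hb].
  apply IZR_le in ha, hb, hq. apply IZR_lt in h1, h2.
  repeat rewrite ?minus_IZR, ?plus_IZR, ?mult_IZR in *.
  split.
  - apply Rmult_lt_reg_r with (IZR b); [lra|].
    pose proof (Rmult_le_pos _ _ hq (Rlt_le _ _ c1)). lra.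
  - apply Rmult_lt_reg_r with (IZR a); [lra|].
    pose proof (Rmult_le_pos _ _ hq (Rlt_le _ _ c2)). lra.
Qed.

Lemma parameter_nonneg e a b q s : e * e = 1 -> 1 <= a <= b ->
  b * b - a * b - a * a = e -> 0 < q < a + b ->
  (0 <= IZR e * (IZR q * (phi - 1) - IZR s) <= 1)%R ->
  0 <= e * (q * a - s * b) /\ 0 <= e * (s * a - q * (b - a)) + a.
Proof.
  intros he hab hc [hq hqb] hs.
  destruct (convergent_sides e a b he hab hc) as [c1 c2].
  assert (ha' : (1 <= IZR a)%R) by (apply IZR_le; lia).
  assert (hb' : (1 <= IZR b)%R) by (apply IZR_le; lia).
  assert (hq' : (0 < IZR q)%R) by (apply IZR_lt; lia).
  assert (hee : (IZR e * IZR e = 1)%R) by (rewrite <- mult_IZR, he; reflexivity).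
  pose proof (Rmult_lt_0_compat _ _ hq' c1) as d1.
  pose proof (Rmult_lt_0_compat _ _ hq' c2) as d2.
  split.
  - (* [s / q] and [(b - a) / a] lie on opposite sides of [phi - 1]. *)
    assert (hu : 0 < e * (q * (b - a) - s * a)).
    { apply lt_IZR. repeat rewrite ?minus_IZR, ?plus_IZR, ?mult_IZR.
      nra. }
    pose proof (no_fraction_between e a b s q he hab hc hqb hu). lia.
  - (* [(s + e) / q] and [a / b] lie on opposite sides of [phi - 1]. *)
    assert (hv : 0 < e * ((s + e) * b - q * a)).
    { apply lt_IZR. repeat rewrite ?minus_IZR, ?plus_IZR, ?mult_IZR.
      replace (IZR e * ((IZR s + IZR e) * IZR b - IZR q * IZR a))%R
        with (IZR e * IZR s * IZR b + (IZR e * IZR e) * IZR b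
              - IZR e * IZR q * IZR a)%R by ring.
      rewrite hee. nra. }
    pose proof (no_fraction_between e a b (s + e) q he hab hc hqb). nia.
Qed.

(** * Solutions in the three scenarios *)

Lemma div_exact_of_congr k u v : 0 < k -> u mod k = v mod k ->
  k * ((u - v) / k) = u - v.
Proof.
  intros hk h. symmetry. apply Z.div_exact; [lia|].
  rewrite Zminus_mod, h, Z.sub_diag. apply Z.mod_0_l. lia.
Qed.

Lemma congr_of_eq k u v q : u = v + q * k -> u mod k = v mod k.
Proof. intros ->. apply Z_mod_plus_full. Qed.

Lemma solution_of_parameter e k n s x y : e * e = 1 -> 2 <= k ->
  (1 <= n)%nat -> k < fib (n + 1) ->
  fib (n + 1) * fib (n + 1) - fib n * fib (n + 1) - fib n * fib n = e ->
  (0 <= IZR e * (IZR (k - 1) * (phi - 1) - IZR s) <= 1)%R ->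
  k * x + 1 = e * ((k - 1) * fib n - s * fib (n + 1)) ->
  k * y + 1 = e * (s * fib n - (k - 1) * (fib (n + 1) - fib n)) + fib n ->
  solution k n (x, y).
Proof.
  intros he hk hn hkb hc hs hx hy.
  assert (hpos : forall z, 0 <= k * z + 1 -> 0 <= z) by (clear - hk; nia).
  pose proof (fib_pos n hn) as hp.
  destruct (parameter_nonneg e (fib n) (fib (n + 1)) (k - 1) s) as [h1 h2];
    trivial; [lia|].
  rewrite <- hx in h1. rewrite <- hy in h2.
  apply solution_iff; [lia|]. do 2 (split; [now apply hpos|]).
  apply (solution_param e); trivial. now exists s.
Qed.

Lemma scenario1_solution k n : 2 <= k -> scenario1 k n ->
  solution k n (0, 0).
Proof.
  intros hk [_ h]. apply solution_iff; lia.
Qed.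

Lemma scenario2_solution k r n : 2 <= k ->
  (IZR r <= IZR (k - 1) * (phi - 1) < IZR r + 1)%R ->
  scenario2 k r n -> solution k n (sol2 k r n).
Proof.
  intros hk hr (hev & hn & hkb & c1 & c2).
  apply div_exact_of_congr in c1, c2; try lia.
  unfold sol2. rewrite fib_pred by lia.
  replace (fib n + r * fib (n + 1) + 1)
    with (fib n + r * fib (n + 1) - -1) by ring.
  apply (solution_of_parameter 1) with r; try lia; try nra.
  now apply cassini_even.
Qed.

Lemma scenario3_solution k r n : 2 <= k ->
  (IZR r <= IZR (k - 1) * (phi - 1) < IZR r + 1)%R ->
  scenario3 k r n -> solution k n (sol3 k r n).
Proof.
  intros hk hr (hod & hn & hkb & c1 & c2).
  apply div_exact_of_congr in c1, c2; try lia.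
  unfold sol3. rewrite fib_pred by lia.
  replace ((r + 1) * fib (n + 1) + fib n - 1)
    with (fib n + (r + 1) * fib (n + 1) - 1) by ring.
  replace (fib (n + 1) + (r - 1) * fib n + 1)
    with ((r - 1) * fib n + fib (n + 1) - -1) by ring.
  apply (solution_of_parameter (-1)) with (r + 1); try lia.
  - now apply cassini_odd.
  - rewrite plus_IZR. lra.
Qed.

Lemma scenario_of_solution k r n x y : 2 <= k ->
  (IZR r <= IZR (k - 1) * (phi - 1) < IZR r + 1)%R ->
  (1 <= n)%nat -> solution k n (x, y) ->
  scenario1 k n \/ scenario2 k r n \/ scenario3 k r n.
Proof.
  intros hk hr hn (hx & hy & h)%solution_iff; [|lia].
  pose proof (fib_pos n hn) as hp.
  assert (hxy : (x = 0 /\ y = 0) \/ 1 <= x + y) by lia.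
  destruct hxy as [[-> ->]|hxy].
  { left. split; [exact hn|]. lia. }
  right.
  assert (hkb : k < fib (n + 1)).
  { assert (1 + fib n <= 1 + fib n * x + fib (n + 1) * y) by nia. nia. }
  destruct (Nat.Even_or_Odd n) as [hpar|hpar]; [left|right].
  - pose proof (cassini_even n hpar) as hc.
    assert (hn2 : (2 <= n)%nat) by (destruct hpar; lia).
    apply (solution_param 1) in h as (s & h1 & h2); trivial.
    assert (hs : (0 < 1 * (IZR (k - 1) * (phi - 1) - IZR s) < 1)%R)
      by (apply (parameter_near 1 (fib n) (fib (n + 1))); trivial; nia).
    assert (s < r + 1) by (apply lt_IZR; rewrite plus_IZR; lra).
    assert (r < s + 1) by (apply lt_IZR; rewrite plus_IZR; lra).
    assert (s = r) by lia. subst s.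
    split; [exact hpar|]. do 2 (split; [lia|]). split.
    + apply congr_of_eq with (fib n - x). lia.
    + apply congr_of_eq with (y + fib (n + 1) - fib n). lia.
  - pose proof (cassini_odd n hpar) as hc.
    apply (solution_param (-1)) in h as (s & h1 & h2); trivial.
    assert (hs : (0 < -1 * (IZR (k - 1) * (phi - 1) - IZR s) < 1)%R)
      by (apply (parameter_near (-1) (fib n) (fib (n + 1))); trivial; nia).
    assert (s < r + 2) by (apply lt_IZR; rewrite plus_IZR; lra).
    assert (r < s) by (apply lt_IZR; lra).
    assert (s = r + 1) by lia. subst s.
    split; [exact hpar|]. do 2 (split; [lia|]). split.
    + apply congr_of_eq with (x + fib n). lia.
    + apply congr_of_eq with (fib (n + 1) - fib n - y). lia.
Qed.

Theorem theorem3p12 (k r : Z) (hk : 2 <= k)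
  (hr : r = Zfloor ((IZR k - 1) / phi)%R) :
  (admissible k <->
     (exists n : nat, scenario1 k n) \/
     (exists n : nat, scenario2 k r n) \/
     (exists n : nat, scenario3 k r n)) /\
  (forall n : nat, scenario1 k n -> unique (solution k n) (0, 0)) /\
  (forall n : nat, scenario2 k r n -> unique (solution k n) (sol2 k r n)) /\
  (forall n : nat, scenario3 k r n -> unique (solution k n) (sol3 k r n)).
Proof.
  apply floor_div_phi in hr.
  assert (huniq : forall n p, (1 <= n)%nat -> solution k n p ->
                  unique (solution k n) p).
  { intros n [x y] hn hp. split; [exact hp|]. intros [x' y'] hp'.
    apply (solution_unique k n); trivial; lia. }
  assert (hadm : forall n p, (1 <= n)%nat -> solution k n p -> admissible k).
  { intros n [x y] hn hp. split; [lia|]. now exists n, x, y. }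
  assert (H1 : forall n, scenario1 k n -> (1 <= n)%nat /\ solution k n (0, 0)).
  { intros n h. split; [apply h|]. now apply scenario1_solution. }
  assert (H2 : forall n, scenario2 k r n ->
               (1 <= n)%nat /\ solution k n (sol2 k r n)).
  { intros n h. split; [destruct h; lia|]. now apply scenario2_solution. }
  assert (H3 : forall n, scenario3 k r n ->
               (1 <= n)%nat /\ solution k n (sol3 k r n)).
  { intros n h. split; [apply h|]. now apply scenario3_solution. }
  split; [split|].
  - intros (_ & n & x & y & hn & h).
    destruct (scenario_of_solution k r n x y hk hr hn h) as [s|[s|s]]; eauto.
  - intros [[n s]|[[n s]|[n s]]];
      [apply H1 in s|apply H2 in s|apply H3 in s]; destruct s; eauto.
  - split; [|split]; intros n s;
      [apply H1 in s|apply H2 in s|apply H3 in s]; destruct s; auto.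
Qed.
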